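(* Let $(X,\mathcal{X},\mu,T)$ be a measure preserving system and let $A\in\mathcal{X}$ be an under-recurrent set, that is, $0<\mu(A)<1$ and $\mu(A\cap T^{-n}A)\leq\mu(A)^2$ for every $n\in\mathbb{N}$. Then $$\sum_{n=1}^\infty\big|\mu(A\cap T^{-n}A)-\mu(A)^2\big|<\frac12.$$
   Context: A measure preserving system is a quadruple $(X,\mathcal{X},\mu,T)$ where $(X,\mathcal{X},\mu)$ is a probability space and $T\colon X\to X$ is a measure preserving transformation. $\mathbb{N}=\{1,2,\ldots\}$. *)

(* Defs.v *)
From HB Require Import structures.
From mathcomp Require Import all_boot all_order all_algebra.
From mathcomp Require Import all_classical all_reals all_analysis.
Set Implicit Arguments.
Unset Strict Implicit.
Unset Printing Implicit Defensive.
Import Order.TTheory GRing.Theory Num.Theory.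
Local Open Scope classical_set_scope.
Local Open Scope ereal_scope.

Definition measure_preserving (d : measure_display) (X : measurableType d)
    (R : realType) (mu : probability X R) (T : X -> X) : Prop :=
  measurable_fun [set: X] T /\
  (forall B : set X, measurable B -> mu (T @^-1` B) = mu B).

(* T^{-n} A is the preimage of A under the n-th iterate; T need not be
   invertible. *)
Definition under_recurrent (d : measure_display) (X : measurableType d)
    (R : realType) (mu : probability X R) (T : X -> X) (A : set X) : Prop :=
  0 < mu A < 1 /\
  (forall n : nat, (1 <= n)%N -> mu (A `&` iter n T @^-1` A) <= mu A ^+ 2).

(* Main.v *)
Require Import Defs.
From mathcomp Require Import all_boot all_order all_algebra.
From mathcomp Require Import all_classical all_reals all_analysis.
From mathcomp Require Import measurable_realfun ring lra zify.
Import Order.TTheory GRing.Theory Num.Theory.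
Local Open Scope classical_set_scope.
Local Open Scope ereal_scope.

(** Let [b n = mu A ^+ 2 - mu (A `&` T^-n A)] for all [n], so that
    [b 0 = mu A ^+ 2 - mu A]. By Cauchy-Schwarz, the number of visits to [A]
    before time [2K] has second moment at least [(2K * mu A) ^+ 2], i.e.
    the matrix [b |i - j|], [i, j < 2K], has nonpositive entry sum. When
    [b n >= 0] for [n >= 1], each of its rows has sum at least
    [b 0 + \sum_(1 <= n <= K) b n], since every [i < 2K] has [K] consecutive
    neighbours on at least one side. Hence the partial sums of the series are
    at most [- b 0 = mu A - mu A ^+ 2 <= 1/4]. *)

Lemma integral_sum_indic (R : realType) (d : measure_display)
    (X : measurableType d) (mu : probability X R) (I : Type) (s : seq I)
    (B : I -> set X) (mB : forall i, measurable (B i)) :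
  \int[mu]_x (\sum_(i <- s) \1_(B i) x)%:E
    = (\sum_(i <- s) fine (mu (B i)))%:E.
Proof.
under eq_integral do rewrite -sumEFin.
rewrite ge0_integral_sum //; last first.
- by move=> i; apply/measurable_EFinP; exact: measurable_indic.
rewrite -sumEFin; apply: eq_bigr => i _.
by rewrite integral_indic // setIT fineK // fin_num_measure.
Qed.

Lemma measurable_sum_indic (R : realType) (d : measure_display)
    (X : measurableType d) (I : Type) (s : seq I)
    (B : I -> set X) (mB : forall i, measurable (B i)) :
  measurable_fun setT (fun x => (\sum_(i <- s) \1_(B i) x)%:E : \bar R).
Proof.
apply/measurable_EFinP; apply: measurable_sum => i; exact: measurable_indic.
Qed.

(** With [N] the number of sets [B i] containing a point, [s] is the mean of [N] and the right-hand
    side is the mean of [N ^+ 2]; integrating [(N - s) ^+ 2 >= 0] compares them. *)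
Lemma sqr_sum_probability_le (R : realType) (d : measure_display)
    (X : measurableType d) (mu : probability X R) (I : finType)
    (B : I -> set X) (mB : forall i, measurable (B i)) :
  ((\sum_i fine (mu (B i))) ^+ 2
     <= \sum_i \sum_j fine (mu (B i `&` B j)) :> R)%R.
Proof.
set s := (\sum_i fine (mu (B i)))%R.
have s0 : (0 <= s)%R by apply: sumr_ge0 => i _; exact: fine_ge0.
have mBI (p : I * I) : measurable (B p.1 `&` B p.2) by exact: measurableI.
rewrite (pair_bigA _ (fun i j => fine (mu (B i `&` B j)))) /=.
(* The cross term of [(N - s) ^+ 2] is moved to the left, so that both sides are nonnegative and the
   monotonicity of the integral applies. *)
have pt x : ((2 * s) * \sum_i \1_(B i) x
    <= \sum_(p : I * I) \1_(B p.1 `&` B p.2) x + s ^+ 2 :> R)%R.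
  rewrite -(pair_bigA _ (fun i j => \1_(B i `&` B j) x)%R) /=.
  have -> : (\sum_i \sum_j \1_(B i `&` B j) x = (\sum_i \1_(B i) x) ^+ 2 :> R)%R.
    rewrite expr2 big_distrlr /=; apply: eq_bigr => i _; apply: eq_bigr => j _.
    by rewrite indicI.
  by move: (\sum_i _)%R => u; have := sqr_ge0 (u - s)%R; nra.
have S0 (J : finType) (C : J -> set X) x : (0 <= \sum_i \1_(C i) x :> R)%R.
  by apply: sumr_ge0 => i _; rewrite indicE.
have : \int[mu]_x ((2 * s)%:E * (\sum_i \1_(B i) x)%:E)
    <= \int[mu]_x ((\sum_(p : I * I) \1_(B p.1 `&` B p.2) x)%:E
                   + cst (s ^+ 2)%:E x).
  apply: ge0_le_integral => //.
  - by move=> x _; rewrite -EFinM lee_fin mulr_ge0 // mulr_ge0.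
  - by apply: emeasurable_funM => //; exact: measurable_sum_indic.
  - by apply: emeasurable_funD => //; exact: measurable_sum_indic.
  - by move=> x _; rewrite -EFinM -EFinD lee_fin.
rewrite ge0_integralZl_EFin //; [|by move=> x _; rewrite lee_fin|
  exact: measurable_sum_indic|by rewrite mulr_ge0].
rewrite ge0_integralD //; [|by move=> x _; rewrite lee_fin|
  exact: measurable_sum_indic|by move=> x _; rewrite lee_fin sqr_ge0].
rewrite integral_cst // [X in _ + _ * X]probability_setT mule1 !integral_sum_indic //.
rewrite -EFinM -EFinD lee_fin -/s; nra.
Qed.

(** Subtraction is truncated, so [i - j + (j - i)] is the distance of [i] and [j]. Off the diagonal,
    row [i] consists of [b 1, ..., b i] on the left and [b 1, ..., b (2K - 1 - i)] on the right. *)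
Lemma toeplitz_row_sum_ge (R : realDomainType) (b : nat -> R)
    (b0 : forall n, (0 < n)%N -> (0 <= b n)%R) (K i : nat) :
  (i < K + K)%N ->
  (b 0%N + \sum_(1 <= n < K.+1) b n
     <= \sum_(j < K + K) b (i - j + (j - i))%N)%R.
Proof.
move=> iK; rewrite -(big_mkord xpredT (fun j => b (i - j + (j - i))%N)).
rewrite [leRHS](big_cat_nat (n := i)) ?leq0n 1?ltnW //= (big_ltn iK) subnn.
have -> : (\sum_(0 <= j < i) b (i - j + (j - i))%N = \sum_(1 <= n < i.+1) b n)%R.
  rewrite big_nat_rev /= big_add1 /=; apply: eq_big_nat => j /andP[_ ji].
  by congr b; lia.
have -> : (\sum_(i.+1 <= j < K + K) b (i - j + (j - i))%N
    = \sum_(1 <= n < (K + K - i)%N) b n)%R.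
  rewrite -add1n big_addn; apply: eq_big_nat => j /andP[_ ji].
  by congr b; lia.
have pos p q : (0 <= \sum_(p.+1 <= n < q) b n)%R.
  rewrite big_seq; apply: sumr_ge0 => n; rewrite mem_index_iota => /andP[n0 _].
  by apply: b0; lia.
have mono p : (K < p)%N -> (\sum_(1 <= n < K.+1) b n <= \sum_(1 <= n < p) b n)%R.
  by move=> Kp; rewrite [leRHS](big_cat_nat (n := K.+1)) //= lerDl.
(* The right part reaches [b K] if [i < K], the left part otherwise; the other part is dropped as
   nonnegative. *)
have [iK'|Ki] := ltnP i K.
- have := mono (K + K - i)%N; have := pos 0%N i.+1.
  by move=> ? /(_ ltac:(lia)); lra.
- have := mono i.+1; have := pos 0%N (K + K - i)%N.
  by move=> ? /(_ ltac:(lia)); lra.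
Qed.

Lemma measurable_preimage_iter (d : measure_display) (X : measurableType d)
    (T : X -> X) (mT : measurable_fun setT T) (A : set X) (n : nat) :
  measurable A -> measurable (iter n T @^-1` A).
Proof.
elim: n A => [//|n IH] A mA; apply: (IH (T @^-1` A)).
by rewrite -[X in measurable X]setTI; exact: mT.
Qed.

Lemma probability_preimage_iter (R : realType) (d : measure_display)
    (X : measurableType d) (mu : probability X R) (T : X -> X)
    (hT : measure_preserving mu T) (A : set X) (n : nat) :
  measurable A -> mu (iter n T @^-1` A) = mu A.
Proof.
case: hT => mT hT; elim: n A => [//|n IH] A mA; rewrite -(hT A) //.
by apply: (IH (T @^-1` A)); rewrite -[X in measurable X]setTI; exact: mT.
Qed.

(** Stationarity: for [i <= j] the left-hand set is the preimage under [iter i T] of the right-hand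
    one. This makes the correlation matrix Toeplitz. *)
Lemma probability_preimage_iterI (R : realType) (d : measure_display)
    (X : measurableType d) (mu : probability X R) (T : X -> X)
    (hT : measure_preserving mu T) (A : set X) (mA : measurable A) (i j : nat) :
  mu (iter i T @^-1` A `&` iter j T @^-1` A)
    = mu (A `&` iter (i - j + (j - i)) T @^-1` A).
Proof.
wlog ij : i j / (i <= j)%N => [hw|].
  by case/orP: (leq_total i j) => ?; [|rewrite setIC addnC]; exact: hw.
(* By definition [i <= j] is [i - j == 0], so [eqP] erases the first difference. *)
rewrite (eqP ij) add0n -[RHS](@probability_preimage_iter _ _ _ _ _ hT _ i).
  by congr (mu _); apply/seteqP; split=> x /=; rewrite -iterD subnK.
by apply: measurableI => //; apply: measurable_preimage_iter => //; case: hT.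
Qed.

Theorem mainTheorem12 (R : realType) (d : measure_display)
    (X : measurableType d) (mu : probability X R) (T : X -> X) (A : set X)
    (hT : measure_preserving mu T) (mA : measurable A)
    (hA : under_recurrent mu T A) :
  \sum_(1 <= n <oo) `| mu (A `&` iter n T @^-1` A) - mu A ^+ 2 |
    < (2^-1 : R)%:E.
Proof.
case: hA => _ hrec.
have mTA n : measurable (iter n T @^-1` A).
  by apply: measurable_preimage_iter => //; case: hT.
set m := fine (mu A).
have muA : mu A = m%:E by rewrite fineK // fin_num_measure.
pose c n := fine (mu (A `&` iter n T @^-1` A)).
have muc n : mu (A `&` iter n T @^-1` A) = (c n)%:E.
  by rewrite fineK // fin_num_measure //; exact: measurableI.
pose b n : R := (m ^+ 2 - c n)%R.
have b_ge0 n : (0 < n)%N -> (0 <= b n)%R.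
  by move=> /hrec; rewrite muA muc -EFin_expe lee_fin subr_ge0.
have b0E : b 0%N = (m ^+ 2 - m)%R by rewrite /b /c /= setIid.
have sum_b_le K : (\sum_(1 <= n < K.+1) b n <= m - m ^+ 2)%R.
  (* The general argument ends by dividing by [K + K]; for [K = 0] the claim is just
     [m ^+ 2 <= m]. *)
  have [->|K0] := posnP K.
    rewrite big_geq // subr_ge0.
    have : (0 <= m)%R by exact: fine_ge0.
    have : (m <= 1)%R by rewrite -lee_fin -muA probability_le1.
    nra.
  have := @sqr_sum_probability_le _ _ _ mu _ (fun i : 'I_(K + K) => _)
    (fun i => mTA i).
  under eq_bigr do rewrite probability_preimage_iter // -/m.
  under [leRHS]eq_bigr do under eq_bigr do rewrite probability_preimage_iterI //.
  rewrite sumr_const card_ord => hsq.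
  have : (\sum_(i < K + K) (b 0%N + \sum_(1 <= n < K.+1) b n)
      <= \sum_(i < K + K) \sum_(j < K + K) b (i - j + (j - i))%N)%R.
    by apply: ler_sum => i _; exact: toeplitz_row_sum_ge.
  rewrite sumr_const card_ord.
  have -> : (\sum_(i < K + K) \sum_(j < K + K) b (i - j + (j - i))%N
    = (m *+ (K + K)) ^+ 2
      - \sum_(i < K + K) \sum_(j < K + K) c (i - j + (j - i))%N)%R.
    under eq_bigr do rewrite sumrB sumr_const card_ord.
    rewrite sumrB sumr_const card_ord; congr (_ - _)%R.
    by rewrite -[in LHS]mulr_natr -[in LHS]mulr_natr -[in RHS]mulr_natr; ring.
  move=> row; rewrite -subr_ge0 -oppr_le0 opprB.
  have : ((b 0%N + \sum_(1 <= n < K.+1) b n) *+ (K + K) <= 0)%R.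
    by rewrite (le_trans row) // subr_le0.
  by rewrite pmulrn_lle0 ?addn_gt0 ?K0 // b0E; lra.
(* Limits preserve only weak inequalities; the gap between 1/4 and 1/2 gives the strict one. *)
apply: (@le_lt_trans _ _ (4^-1 : R)%:E); last by rewrite lte_fin; lra.
apply: lime_le; first by apply: is_cvg_nneseries.
apply: nearW => -[|K]; first by rewrite big_geq // lee_fin; lra.
rewrite (@eq_big_nat _ _ _ _ _ _ (fun n => (b n)%:E)); last first.
  move=> n /andP[n0 _]; rewrite muc muA -EFin_expe -EFinB /=; congr EFin.
  by rewrite distrC ger0_norm // b_ge0.
rewrite sumEFin lee_fin (le_trans (sum_b_le K)) //.
(* [m - m ^+ 2] is maximal at [m = 1/2]. *)
by have := sqr_ge0 (m - 2^-1)%R; nra.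
Qed.
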